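(* Let $S$ be a finite set with $|S|=n$, and let $\mu=\sum_{f\in\mathcal F_S}\alpha_f\delta_f$ be a probability measure on $\mathcal F_S$, where $\alpha$ is a probability mass function on $\mathcal F_S$ (so that $f\in\operatorname{supp}(\mu)$ if and only if $\alpha_f>0$). (a) We have $$k(\mu)=\inf\bigl\{\operatorname{rank}(M_{f_t}M_{f_{t-1}}\cdots M_{f_1}) : f_1,f_2,\dots,f_t\in\operatorname{supp}(\mu),\ t\ge 1\bigr\}.$$ (b) There exists $T=T(n)$, depending only on $n$, such that the infimum in (a) is achieved by some product $M_{f_t}M_{f_{t-1}}\cdots M_{f_1}$ with $f_1,\dots,f_t\in\operatorname{supp}(\mu)$ and $1\le t\le T$.
   Context: $S$ is a non-empty finite set, $\mathcal F_S$ is the set of all functions from $S$ to $S$, and $\mathbb N=\{1,2,\dots\}$. For a probability measure $\mu$ on $\mathcal F_S$, $\operatorname{supp}(\mu)$ is its support and $\delta_f$ is the Dirac mass at $f$. For $f\in\mathcal F_S$, $M_f$ is the $S\times S$ matrix with $(i,j)$ entry $1$ if $f(i)=j$ and $0$ otherwise. Coalescence number: let $F=(F_s:s\in\mathbb N)$ be independent random functions each with law $\mu$, let $\boldsymbol\mu=\prod_{i\in\mathbb N}\mu$ be the law of $F$, and let $\vec F_t=F_t\circ F_{t-1}\circ\cdots\circ F_1$. Define the equivalence relation $\sim$ on $S$ by $i\sim j$ if and only if $\vec F_t(i)=\vec F_t(j)$ for some $t\in\mathbb N$, and let $k(F)$ be the number of equivalence classes of $\sim$. It is known that $k(F)$ is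 $\boldsymbol\mu$-a.s. constant; the coalescence number $k(\mu)$ is this almost surely constant value. *)

(* Defs.v *)
From HB Require Import structures.
From mathcomp Require Import all_boot all_order all_algebra.
From mathcomp Require Import all_classical all_reals all_analysis measurable_realfun.

Set Implicit Arguments.
Unset Strict Implicit.
Unset Printing Implicit Defensive.
Import Order.TTheory GRing.Theory Num.Theory.
Local Open Scope classical_set_scope.
Local Open Scope ring_scope.

Definition selfmap (S : finType) := {ffun S -> S}.

HB.instance Definition _ (S : finType) := Finite.on (selfmap S).
HB.instance Definition _ (S : finType) :=
  isPointed.Build (selfmap S) [ffun x => x].
HB.instance Definition _ (S : finType) :=
  @isMeasurable.Build default_measure_display (selfmap S) discrete_measurable
    discrete_measurable0 discrete_measurableC discrete_measurableU.

Definition coord_events (S : finType) : set (set (nat -> selfmap S)) :=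
  \bigcup_s preimage_set_system setT (fun F => F s) measurable.

(* Sequences are indexed from 0: the value of [F : mapseq S] at [s] is the
   random map usually written F_(s+1). *)
Definition mapseq (S : finType) := g_sigma_algebraType (@coord_events S).

HB.instance Definition _ (S : finType) := Measurable.on (mapseq S).

(* The coordinates are independent with common law [mu]; as these rectangles
   generate the sigma-algebra of [mapseq S], at most one [P] qualifies. *)
Definition is_product_law (R : realType) (S : finType)
    (mu : probability (selfmap S) R) (P : probability (mapseq S) R) : Prop :=
  forall (t : nat) (A : nat -> set (selfmap S)),
    P [set F | forall s, (s < t)%N -> A s (F s)] =
    (\prod_(s < t) mu (A s))%E.

(* Existence of the infinite product law: Lebesgue measure on [0, 1[ is pushed
   forward along the expansion of x whose digits are chosen by a partition of
   [0, 1[ into intervals of lengths [q f]. *)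
Section product_law_existence.
Variables (R : realType) (S : finType) (mu : probability (selfmap S) R).
Local Notation T := (selfmap S).
Local Notation RM := (measurableTypeR R).

Let q (f : T) : R := fine (mu [set f]).

Let q_ge0 f : 0 <= q f.
Proof. by rewrite /q fine_ge0. Qed.

Let measure_finU d (U : measurableType d) (m : {measure set U -> \bar R})
    (I : finType) (D : set I) (F : I -> set U) :
  trivIset setT F -> (forall i, measurable (F i)) ->
  m (\bigcup_(i in D) F i) = (\sum_(i | i \in D) m (F i))%E.
Proof.
move=> tF mF; rewrite measure_fin_bigcup//=; last exact: sub_trivIset tF.
rewrite (bigfs _ (r := index_enum I)) ?index_enum_uniq//.
  by apply: eq_fsbigl; apply/seteqP; split=> i /=; rewrite inE.
by move=> i _; rewrite mem_index_enum.
Qed.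

Let muE (A : set T) : mu A = (\sum_(f | f \in A) q f)%:E.
Proof.
rewrite [X in mu X](_ : A = \bigcup_(f in A) [set f]); last first.
  by apply/seteqP; split=> [f Af|f [g Ag ->//]]; exists f.
rewrite measure_finU//; last by move=> f g _ _ [h [/= <- <-]].
rewrite -sumEFin; apply: eq_bigr => f _.
by rewrite /q fineK// fin_num_measure.
Qed.

Let sum_q : \sum_f q f = 1.
Proof.
apply: EFin_inj; rewrite -(probability_setT mu) muE; congr _%:E.
by apply: eq_bigl => f; rewrite in_setT.
Qed.

Let c (i : nat) : R := \sum_(f | (enum_rank f < i)%N) q f.

Let c0 : c 0 = 0.
Proof. by rewrite /c big_pred0. Qed.

Let cN : c #|T| = 1.
Proof. by rewrite /c -sum_q; apply: eq_bigl => f; rewrite ltn_ord. Qed.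

Let cS f : c (enum_rank f).+1 = c (enum_rank f) + q f.
Proof.
rewrite /c (bigD1 f)/= ?ltnS// addrC; congr (_ + _); apply: eq_bigl => g.
by rewrite ltnS [RHS]ltn_neqAle andbC -(inj_eq enum_rank_inj).
Qed.

Let le_c i j : (i <= j)%N -> c i <= c j.
Proof.
move=> ij; rewrite /c [leLHS]big_mkcond [leRHS]big_mkcond; apply: ler_sum => f _.
case: ifPn => [fi|_]; first by rewrite (leq_trans fi ij).
by case: ifP.
Qed.

Let J (f : T) (x : R) := c (enum_rank f) <= x < c (enum_rank f).+1.

Let J_inj f g x : J f x -> J g x -> f = g.
Proof.
move=> /andP[f1 f2] /andP[g1 g2]; apply: enum_rank_inj; apply/val_inj/eqP => /=.
rewrite eqn_leq; apply/andP; split; rewrite leqNgt; apply/negP => /le_c.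
  by move=> /(lt_le_trans g2)/lt_le_trans/(_ f1); rewrite ltxx.
by move=> /(lt_le_trans f2)/lt_le_trans/(_ g1); rewrite ltxx.
Qed.

Let J_cover x : 0 <= x < 1 -> exists f, J f x.
Proof.
move=> /andP[x0 x1]; have ex : exists i, x < c i by exists #|T|; rewrite cN.
case: (ex_minnP ex) => -[|i] xi mini; first by move: xi; rewrite c0 ltNge x0.
have iN : (i < #|T|)%N by apply: mini; rewrite cN.
exists (enum_val (Ordinal iN)); rewrite /J enum_valK/= xi andbT leNgt.
by apply/negP => /mini; rewrite ltnn.
Qed.

Let sym (x : R) : T := odflt point [pick f | J f x].

Let symE f x : J f x -> sym x = f.
Proof.
rewrite /sym => fx; case: pickP => [g gx|/(_ f)]/=; last by rewrite fx.
exact: J_inj gx fx.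
Qed.

Let shift (x : R) : R := (x - c (enum_rank (sym x))) / q (sym x).

Let X (x : RM) : mapseq S := fun s => sym (iter s shift x).

Let measurable_J f : measurable ([set x | J f x] : set RM).
Proof.
rewrite (_ : [set x | J f x] = `[c (enum_rank f), c (enum_rank f).+1[%classic).
  exact: measurable_itv.
by apply/seteqP; split=> x /=; rewrite in_itv.
Qed.

Let measurable_sym : measurable_fun setT (sym : RM -> T).
Proof.
move=> _ B _; rewrite setTI.
have -> : sym @^-1` B = \bigcup_(f in B) [set x | J f x] `|`
    (if point \in B then ~` \bigcup_f [set x | J f x] else set0).
  apply/seteqP; split=> [x|x [[f Bf fx]|]]; last rewrite /sym/=.
  - rewrite /sym/=; case: pickP => [f fx Bf|nx Bp]; first by left; exists f.
    by right; rewrite mem_set//= => -[f _ /=]; rewrite nx.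
  - by rewrite /= (symE fx).
  case: ifPn => //; rewrite in_setE => Bp nx; case: pickP => //= f fx.
  by exfalso; apply: nx; exists f.
apply: measurableU; last case: ifPn => // _; last apply: measurableC;
  by apply: fin_bigcup_measurable => //; exact: finite_finset.
Qed.

Let measurable_shift : measurable_fun setT (shift : RM -> RM).
Proof.
move=> _ B mB; rewrite setTI.
have -> : shift @^-1` B = \bigcup_f (sym @^-1` [set f] `&`
    (fun x => (x - c (enum_rank f)) / q f) @^-1` B).
  apply/seteqP; split=> [x Bx|x [f _ [/= <-]]//]; by exists (sym x).
apply: fin_bigcup_measurable => [|f _]; first exact: finite_finset.
apply: measurableI; rewrite -[X in measurable X]setTI.
  exact: measurable_sym.
suff : measurable_fun [set: RM] (fun x : RM => (x - c (enum_rank f)) / q f : RM).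
  exact.
by apply: measurable_funM => //; exact: measurable_funB.
Qed.

Let measurable_X : measurable_fun setT X.
Proof.
apply: (@measurability _ _ _ (mapseq S) setT X (@coord_events S) erefl).
move=> _ [_ [s _ [B _ <-]] <-].
rewrite setTI setTI -[X in measurable X]setTI.
have : measurable_fun [set: RM] (sym \o iter s shift : RM -> T).
  apply: measurableT_comp; first exact: measurable_sym.
  elim: s => [|s IH]; first exact: measurable_id.
  exact: measurableT_comp measurable_shift IH.
exact.
Qed.

Let I01 : set RM := `[0, 1[%classic.

Let mI01 : measurable I01.
Proof. exact: measurable_itv. Qed.

Let U01 : set RM -> \bar R := mrestr (@lebesgue_measure R) mI01.

HB.instance Definition _ := Measure.on U01.

Let U01T : U01 setT = 1%E.
Proof.
rewrite /U01 /mrestr setTI /I01 lebesgue_measure_itv/= lte_fin ltr01.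
by rewrite oppr0 adde0.
Qed.

HB.instance Definition _ := Measure_isProbability.Build _ _ _ U01 U01T.

HB.instance Definition _ := isMeasurableFun.Build _ _ _ _ X measurable_X.

Let law : probability (mapseq S) R := distribution U01 X.

Let lo := foldr (fun f a => c (enum_rank f) + q f * a) 0.
Let len := foldr (fun f a => q f * a) 1.

Let lo_ge0 w : 0 <= lo w.
Proof.
by elim: w => //= f w IH; rewrite addr_ge0 ?mulr_ge0// /c sumr_ge0.
Qed.

Let len_ge0 w : 0 <= len w.
Proof. by elim: w => //= f w IH; rewrite mulr_ge0. Qed.

Let hi_le1 w : lo w + len w <= 1.
Proof.
elim: w => [|f w IH]/=; first by rewrite add0r.
rewrite -addrA -mulrDr (@le_trans _ _ (c (enum_rank f).+1))//; last first.
  by rewrite -cN le_c.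
by rewrite cS lerD2l ler_piMr.
Qed.

Let wordP w x : 0 <= x < 1 ->
  (forall s, (s < size w)%N -> sym (iter s shift x) = nth point w s) <->
  lo w <= x < lo w + len w.
Proof.
elim: w x => [|f w IH] x x01 /=; first by rewrite add0r.
have [g gx] := J_cover x01; have symg := symE gx.
have q_gt0 : 0 < q g.
  by move: gx => /andP[]; rewrite cS => /le_lt_trans/[apply]; rewrite ltrDl.
have shiftE : shift x = (x - c (enum_rank g)) / q g by rewrite /shift symg.
have shift01 : 0 <= shift x < 1.
  move: gx => /andP[]; rewrite cS shiftE -subr_ge0 => h1 h2.
  by rewrite divr_ge0//= ltr_pdivrMr// mul1r ltrBlDl.
have stepE : (lo w <= shift x < lo w + len w) =
    (c (enum_rank g) + q g * lo w <= x <
     c (enum_rank g) + q g * lo w + q g * len w).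
  rewrite shiftE ler_pdivlMr// ltr_pdivrMr// lerBrDl ltrBlDl mulrDl addrA.
  by rewrite !(mulrC (q g)).
have tailE : (forall s, (s < size w)%N -> sym (iter s.+1 shift x) = nth point w s)
    <-> lo w <= shift x < lo w + len w.
  rewrite -IH//; split=> h s sw; have := h s sw; by rewrite iterSr.
split=> [h|h].
  have gf : g = f by have := h 0%N isT; rewrite /= symg.
  by rewrite -gf -stepE -tailE => s sw; exact: (h s.+1 sw).
have gf : g = f.
  apply: J_inj gx _; rewrite /J; case/andP: h => h1 h2; apply/andP; split.
    by rewrite (le_trans _ h1)// lerDl mulr_ge0.
  rewrite (lt_le_trans h2)// cS -addrA -mulrDr lerD2l ler_piMr//.
case=> [_|s sw]; first by rewrite /= symg gf.
by move: s sw; rewrite tailE stepE gf.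
Qed.

Let law_word w :
  law [set F | forall s, (s < size w)%N -> F s = nth point w s] = (len w)%:E.
Proof.
rewrite /law /= /distribution /pushforward /= /U01 /mrestr.
rewrite (_ : _ `&` _ = `[lo w, lo w + len w[%classic).
  rewrite lebesgue_measure_itv/= lte_fin; case: ifPn => [_|].
    by rewrite -EFinD addrC addKr.
  by rewrite ltrDl -leNgt => h; congr _%:E; apply/eqP; rewrite eq_le len_ge0 h.
apply/seteqP; split=> [x [/= h]|x /=].
  rewrite /I01/= in_itv/= => x01; rewrite in_itv/=.
  by apply/(wordP w x01).
rewrite in_itv/= => h; have x01 : 0 <= x < 1.
  case/andP: h => h1 h2; rewrite (le_trans (lo_ge0 w) h1)/=.
  exact: lt_le_trans h2 (hi_le1 w).
split; last by rewrite /I01/= in_itv.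
exact/(wordP w x01).
Qed.

Lemma product_law_exists : exists P : probability (mapseq S) R, is_product_law mu P.
Proof.
exists law => t A.
pose C (w : {ffun 'I_t -> T}) : set (mapseq S) :=
  [set F | forall s : 'I_t, F s = w s].
have CE w : C w = [set F | forall s, (s < size (codom w))%N ->
    F s = nth point (codom w) s].
  have e (s : 'I_t) : nth point (codom w) s = w s.
    by rewrite (nth_map s) -?cardE ?card_ord// nth_ord_enum.
  apply/seteqP; split=> F /= h s.
    by rewrite size_codom card_ord => st; rewrite (h (Ordinal st)) -(e (Ordinal st)).
  by rewrite h ?e// size_codom card_ord.
have mC w : measurable (C w).
  have -> : C w = \bigcap_(s in [set: 'I_t]) [set F : mapseq S | F s = w s].
    by apply/seteqP; split=> F /= h s; [move=> _; exact: h|exact: h].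
  apply: fin_bigcap_measurable => [|s _]; first exact: finite_finset.
  apply: sub_sigma_algebra; exists (val s) => //; exists [set w s] => //.
  by rewrite setTI.
have lawC w : law (C w) = (\prod_s q (w s))%:E.
  rewrite CE law_word; congr _%:E.
  rewrite (_ : len _ = \prod_(f <- codom w) q f).
    by rewrite big_image.
  by elim: (codom w) => [|f u IH]/=; rewrite ?big_nil// big_cons IH.
rewrite [X in law X](_ : _ =
    \bigcup_(w in [set w : {ffun 'I_t -> T} | forall s : 'I_t, A s (w s)]) C w); last first.
  apply/seteqP; split=> F /=.
    move=> h; exists [ffun s : 'I_t => F s] => /= s; last by rewrite ffunE.
    by rewrite ffunE; exact: h.
  by move=> [w /= wA wF] s st; rewrite (wF (Ordinal st)); exact: wA (Ordinal st).
rewrite measure_finU//; last first.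
  by move=> v w _ _ [F [Fv Fw]]; apply/ffunP => s; rewrite -Fv -Fw.
rewrite (eq_bigr (fun w : {ffun 'I_t -> T} => (\prod_s q (w s))%:E)); last first.
  by move=> w _; exact: lawC.
rewrite sumEFin; under [RHS]eq_bigr do rewrite muE.
rewrite prodEFin; congr _%:E.
under [RHS]eq_bigr do rewrite big_mkcond/=.
rewrite bigA_distr_bigA/= big_mkcond/=; apply: eq_bigr => w _.
case: ifPn => [|nw].
  by rewrite in_setE => wA; apply: eq_bigr => s _; rewrite mem_set//; exact: wA.
have [s ns] : exists s : 'I_t, ~ A s (w s).
  by apply/existsNP => wA; move: nw; rewrite notin_setE; apply => s; exact: wA.
by rewrite (bigD1 s)//= memNset// mul0r.
Qed.

End product_law_existence.

Definition product_law (R : realType) (S : finType)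
    (mu : probability (selfmap S) R) : probability (mapseq S) R :=
  sval (cid (product_law_exists mu)).

Lemma product_lawP (R : realType) (S : finType)
    (mu : probability (selfmap S) R) : is_product_law mu (product_law mu).
Proof. exact: svalP (cid (product_law_exists mu)). Qed.

(* [forward F t] is F_t \o ... \o F_1 in the 1-based numbering. *)
Fixpoint forward (S : finType) (F : mapseq S) (t : nat) : S -> S :=
  if t is t'.+1 then F t' \o forward F t' else id.

Definition coalesce (S : finType) (F : mapseq S) (i j : S) : Prop :=
  exists t, (0 < t)%N /\ forward F t i = forward F t j.

Lemma coalesce_refl (S : finType) (F : mapseq S) i : coalesce F i i.
Proof. by exists 1%N. Qed.

Lemma coalesce_sym (S : finType) (F : mapseq S) i j :
  coalesce F i j -> coalesce F j i.
Proof. by move=> [t [t0 e]]; exists t. Qed.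

Lemma coalesce_trans (S : finType) (F : mapseq S) i j k :
  coalesce F i j -> coalesce F j k -> coalesce F i k.
Proof.
have later i' j' s d :
    forward F s i' = forward F s j' -> forward F (d + s) i' = forward F (d + s) j'.
  by move=> e; elim: d => //= d ->.
move=> [s [s0 es]] [t [t0 et]]; exists (t + s)%N; rewrite addn_gt0 t0; split=> //.
by rewrite (later _ _ _ t es) addnC (later _ _ _ s et).
Qed.

Definition num_classes (S : finType) (F : mapseq S) : nat :=
  #|equivalence_partition (fun i j => `[< coalesce F i j >]) [set: S]|.

(* [xget] picks the almost surely constant value of [num_classes]; such a value
   is unique since [product_law mu] is a probability measure. *)
Definition coalescence_number (R : realType) (S : finType)
    (mu : probability (selfmap S) R) : nat :=
  xget 0%N [set k | \forall F \ae product_law mu, num_classes F = k].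

Definition supp (R : realType) (S : finType)
    (mu : probability (selfmap S) R) : set (selfmap S) :=
  [set f | (0 < mu [set f])%E].

(* Rows and columns are indexed by S through [enum_val]. *)
Definition selfmap_mx (R : realType) (S : finType) (f : selfmap S) :
    'M[R]_#|S| :=
  \matrix_(i, j) (f (enum_val i) == enum_val j)%:R.

(* For fs = [:: f_1; ...; f_t] this is M_(f_t) *m ... *m M_(f_1). *)
Definition word_mx (R : realType) (S : finType) (fs : seq (selfmap S)) :
    'M[R]_#|S| :=
  \big[mulmx/1%:M]_(f <- rev fs) selfmap_mx R f.

Definition supp_words (R : realType) (S : finType)
    (mu : probability (selfmap S) R) : set (seq (selfmap S)) :=
  [set fs | (0 < size fs)%N /\ forall f, f \in fs -> supp mu f].

(* Main.v *)
Require Import Defs.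
From mathcomp Require Import all_boot all_order all_algebra.
From mathcomp Require Import all_classical all_reals all_analysis.
Import Order.TTheory GRing.Theory Num.Theory.

(** The matrix of a self-map has rank the size of its image, and reversing a
    word keeps its letters in the support, so the infimum in (a) is the least
    image size r of a composition of maps from the support; the values being
    natural numbers, it is attained by some word w.

    Almost surely every F_s lies in the support ([ae_supp]) and w occurs as a
    block of consecutive letters of F ([ae_occurs]).  For such an F
    ([num_classes_occurs]), once w has been read the image of [forward F t] has
    at most r points, and it never has fewer by minimality of r; hence later
    maps are injective on that image and merge no further points.  The classes
    of ~ are then the fibers of [forward F t], and there are r of them.

    That w occurs comes from independence: the blocks of positions
    [b * size w, (b + 1) * size w) avoid w for all b < N with probability
    (1 - p) ^ N, where p > 0 is the probability of w
    ([product_law_avoids_rect]).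

    For (b), a word longer than the number n ^ n of self-maps has two distinct
    prefixes with the same composition; deleting the letters in between does
    not change the composition of the word ([shorten_word]).  So T(n) = n ^ n
    is enough. *)

Set Implicit Arguments.
Unset Strict Implicit.
Unset Printing Implicit Defensive.
Local Open Scope ring_scope.

(** * Compositions along words and their images *)

(** The head acts first, as F_1 does in [forward], whereas in [word_mx] it acts
    last. *)
Definition run (S : finType) (fs : seq (selfmap S)) (x : S) : S :=
  foldl (fun y (f : selfmap S) => f y) x fs.

Definition image_card (S : finType) (h : S -> S) : nat := #|h @: [set: S]|.

Lemma run_cat (S : finType) (u v : seq (selfmap S)) :
  run (u ++ v) = run v \o run u.
Proof. by apply/funext => x; rewrite /run foldl_cat. Qed.

Lemma forward_run (S : finType) (F : mapseq S) t : forward F t = run (mkseq F t).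
Proof.
elim: t => // t IH; apply/funext => x.
by rewrite mkseqS -cats1 run_cat /= IH.
Qed.

Lemma forwardD (S : finType) (F : mapseq S) t s :
  forward F (t + s) = run (mkseq (fun i => F (t + i)%N) s) \o forward F t.
Proof.
rewrite !forward_run -run_cat /mkseq iotaD map_cat add0n.
by rewrite -[in iota t s](addn0 t) iotaDl -map_comp.
Qed.

Lemma image_card_comp (S : finType) (g h : S -> S) :
  (image_card (g \o h) <= image_card g)%N.
Proof.
rewrite /image_card imset_comp; apply: subset_leq_card.
by apply: imsetS; apply/fintype.subsetP => x; rewrite inE.
Qed.

(** A map that does not shrink the image of [h] is injective on it: this is what
    stops coalescence once the image has its least possible size. *)
Lemma comp_image_card_inj (S : finType) (g h : S -> S) i j :
  (image_card h <= image_card (g \o h))%N -> g (h i) = g (h j) -> h i = h j.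
Proof.
rewrite /image_card imset_comp => le_im egh.
have /imset_injP inj : #|g @: (h @: [set: S])| == #|h @: [set: S]|.
  by rewrite eqn_leq leq_imset_card.
by apply: inj egh; rewrite imset_f.
Qed.

(** Classes of the kernel of [h] are its nonempty fibers, which are indexed by
    the points of the image. *)
Lemma card_kernel_classes (S : finType) (e : rel S) (h : S -> S) :
  (forall i j, e i j = (h i == h j)) ->
  #|equivalence_partition e [set: S]| = image_card h.
Proof.
move=> eh; pose fiber y := [set j : S | y == h j].
have -> : equivalence_partition e [set: S] = fiber @: (h @: [set: S]).
  rewrite -imset_comp; apply: eq_imset => i /=.
  by apply/setP => j; rewrite !inE eh.
rewrite card_in_imset// => _ _ /imsetP[i _ ->] /imsetP[j _ ->] /setP/(_ i).
by rewrite !inE eqxx => /esym/eqP.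
Qed.

(** If [fs] is longer than the number of self-maps, the pigeonhole principle
    gives two nonempty prefixes with the same composition; cutting out the
    letters between their ends yields a shorter word with the same
    composition. *)
Lemma shorten_word (S : finType) (fs : seq (selfmap S)) : (0 < size fs)%N ->
  exists gs, [/\ (0 < size gs <= #|selfmap S|)%N, {subset gs <= fs}
                 & run gs = run fs].
Proof.
have [n] := ubnP (size fs); elim: n fs => // n IH fs sn s0.
have [small|large] := leqP (size fs) #|selfmap S|.
  by exists fs; split=> //; rewrite s0.
pose prefix_map (i : 'I_(size fs)) : selfmap S := [ffun x => run (take i.+1 fs) x].
have /injectivePn[i0 [j0 neq0 eq0]] : ~~ injectiveb prefix_map.
  by apply/injectiveP => /leq_card; rewrite card_ord leqNgt large.
wlog ltij : i0 j0 neq0 eq0 / (i0 < j0)%N.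
  move=> W; have := neq0; rewrite neq_ltn => /orP[]; first exact: W.
  by apply: W; rewrite 1?eq_sym.
pose gs := take i0.+1 fs ++ drop j0.+1 fs.
have sgs : (size gs < size fs)%N.
  rewrite size_cat size_drop size_takel//.
  by rewrite -[ltnRHS](subnKC (ltn_ord j0)) ltn_add2r ltnS.
have runE : run gs = run fs.
  rewrite -[in RHS](cat_take_drop j0.+1 fs) !run_cat; congr (_ \o _).
  by apply/funext => x; have /ffunP/(_ x) := eq0; rewrite !ffunE.
have gs0 : (0 < size gs)%N.
  by rewrite size_cat size_takel// addSn.
have [ks [ks1 ks2 ks3]] := IH gs (leq_trans sgs sn) gs0.
exists ks; split=> //; last by rewrite ks3.
move=> f /ks2; rewrite mem_cat => /orP[/mem_take|/mem_drop]//.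
Qed.

(** * The matrix of a self-map *)

(** Matrices act on row vectors here, hence the reversal of the order. *)
Lemma selfmap_mxM (R : realType) (S : finType) (f g : S -> S) :
  selfmap_mx R (finfun f) *m selfmap_mx R (finfun g) = selfmap_mx R (finfun (g \o f)).
Proof.
apply/matrixP => i j; rewrite !mxE (bigD1 (enum_rank (f (enum_val i))))//=.
rewrite !mxE !ffunE enum_rankK eqxx mul1r big1 ?addr0// => k ki.
rewrite !mxE ffunE; case: eqP => [e|]; last by rewrite mul0r.
by move: ki; rewrite e enum_valK eqxx.
Qed.

Lemma word_mxE (R : realType) (S : finType) (fs : seq (selfmap S)) :
  word_mx R fs = selfmap_mx R (finfun (run (rev fs))).
Proof.
rewrite /word_mx; elim: (rev fs) => [|f u IH]/=.
  by rewrite big_nil; apply/matrixP => i j; rewrite !mxE ffunE (inj_eq enum_val_inj).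
by rewrite big_cons IH -[X in selfmap_mx R X *m _]ffunK selfmap_mxM.
Qed.

(** The factorization of [h] through its image writes the matrix as [A *m B];
    the inclusion matrix [B] has orthonormal rows, and a section of [h] over
    its image gives a left inverse [A'] of [A]. *)
Lemma rank_selfmap_mx (R : realType) (S : finType) (h : S -> S) :
  \rank (selfmap_mx R (finfun h)) = image_card h.
Proof.
pose D := h @: [set: S]; pose r := #|D|.
pose A : 'M[R]_(#|S|, r) := \matrix_(i, k) (h (enum_val i) == enum_val k)%:R.
pose B : 'M[R]_(r, #|S|) := \matrix_(k, j) (enum_val k == enum_val j)%:R.
have sec (k : 'I_r) : exists x, h x == enum_val k.
  by have /imsetP[x _ ->] := enum_valP k; exists x.
pose A' : 'M[R]_(r, #|S|) := \matrix_(k, i) (enum_val i == xchoose (sec k))%:R.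
(* In each product computed below, the rows of the left factor are unit
   vectors. *)
have unit_row m n p (X : 'M[R]_(m, n)) (Y : 'M[R]_(n, p)) (c : 'I_m -> 'I_n) :
    (forall i k, X i k = (k == c i)%:R) -> X *m Y = \matrix_(i, j) Y (c i) j.
  move=> XE; apply/matrixP => i j; rewrite !mxE (bigD1 (c i))//=.
  by rewrite XE eqxx mul1r big1 ?addr0// => k /negPf ki; rewrite XE ki mul0r.
have hD x : h x \in D by rewrite imset_f.
have AB : selfmap_mx R (finfun h) = A *m B.
  rewrite (@unit_row _ _ _ _ _ (fun i => enum_rank_in (hD (enum_val i)) (h (enum_val i)))).
    by apply/matrixP => i j; rewrite !mxE ffunE enum_rankK_in.
  move=> i k; rewrite mxE -(inj_eq enum_val_inj) enum_rankK_in//.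
  by rewrite eq_sym.
have BB : B *m B^T = 1%:M.
  rewrite (@unit_row _ _ _ _ _ (fun k => enum_rank (enum_val k))).
    apply/matrixP => i j; rewrite !mxE enum_rankK (inj_eq enum_val_inj).
    by rewrite eq_sym.
  by move=> k j; rewrite mxE -(inj_eq enum_val_inj) enum_rankK eq_sym.
have AA : A' *m A = 1%:M.
  rewrite (@unit_row _ _ _ _ _ (fun k => enum_rank (xchoose (sec k)))).
    apply/matrixP => i j; rewrite !mxE enum_rankK (eqP (xchooseP (sec i))).
    by rewrite (inj_eq enum_val_inj).
  by move=> k j; rewrite mxE -(inj_eq enum_val_inj) enum_rankK.
rewrite AB mxrankMfree; last by apply/row_freeP; exists B^T.
apply/eqP; rewrite eqn_leq rank_leq_col/=.
by have := mxrankM_maxr A' A; rewrite AA mxrank1.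
Qed.

(** * Random words contain every word in the support *)

Local Open Scope classical_set_scope.

Lemma measure_supp_compl (R : realType) (S : finType)
    (mu : probability (selfmap S) R) : mu (~` supp mu) = 0%E.
Proof.
have -> : ~` supp mu = \bigcup_(f in ~` supp mu) [set f].
  by apply/seteqP; split=> [f nf|f [g ng ->//]]; exists f.
rewrite measure_fin_bigcup//; last 2 first.
- exact: finite_finset.
- by move=> f g _ _ [h [/= <- <-]].
rewrite fsbig1// => f /negP; rewrite -leNgt => f0.
by apply/eqP; rewrite -measure_le0.
Qed.

Lemma supp_nonempty (R : realType) (S : finType)
    (mu : probability (selfmap S) R) : exists f, supp mu f.
Proof.
apply: contrapT => /forallNP none; have := measure_supp_compl mu.
have -> : ~` supp mu = setT by apply/seteqP; split=> f // _; exact: none.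
by rewrite probability_setT => /eqP; rewrite onee_eq0.
Qed.

(** Cylinder events, on which [is_product_law] prescribes the probability. *)
Definition rect (S : finType) (A : nat -> set (selfmap S)) (t : nat) :
  set (mapseq S) := [set F | forall s, (s < t)%N -> A s (F s)].

Definition occurs (S : finType) (w : seq (selfmap S)) (a : nat) :
  set (mapseq S) := [set F | forall i, (i < size w)%N -> F (a + i)%N = nth point w i].

(** Only disjoint blocks of positions are tested, as these are independent. *)
Definition avoids (S : finType) (w : seq (selfmap S)) (N : nat) :
  set (mapseq S) :=
  [set F | forall b, (b < N)%N -> ~ occurs w (b * size w) F].

Lemma measurable_coord (S : finType) s (A : set (selfmap S)) :
  measurable [set F : mapseq S | A (F s)].
Proof. by apply: sub_sigma_algebra; exists s => //; exists A => //; rewrite setTI. Qed.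

Lemma measurable_rect (S : finType) (A : nat -> set (selfmap S)) t :
  measurable (rect A t).
Proof.
have -> : rect A t = \bigcap_(s in `I_t) [set F : mapseq S | A s (F s)] by [].
apply: fin_bigcap_measurable => [|s _]; first exact: finite_II.
exact: measurable_coord.
Qed.

Lemma measurable_occurs (S : finType) (w : seq (selfmap S)) a :
  measurable (occurs w a).
Proof.
have -> : occurs w a = \bigcap_(i in `I_(size w))
    [set F : mapseq S | [set nth point w i] (F (a + i)%N)] by [].
apply: fin_bigcap_measurable => [|s _]; first exact: finite_II.
exact: measurable_coord.
Qed.

Lemma measurable_avoids (S : finType) (w : seq (selfmap S)) N :
  measurable (avoids w N).
Proof.
have -> : avoids w N = \bigcap_(b in `I_N) ~` occurs w (b * size w) by [].
apply: fin_bigcap_measurable => [|s _]; first exact: finite_II.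
by apply: measurableC; exact: measurable_occurs.
Qed.

Definition word_prob (R : realType) (S : finType)
    (mu : probability (selfmap S) R) (w : seq (selfmap S)) : R :=
  \prod_(0 <= i < size w) fine (mu [set nth point w i]).

Definition rect_prob (R : realType) (S : finType)
    (mu : probability (selfmap S) R) (A : nat -> set (selfmap S)) (t : nat) : R :=
  \prod_(0 <= s < t) fine (mu (A s)).

Lemma product_law_rect (R : realType) (S : finType)
    (mu : probability (selfmap S) R) A t :
  product_law mu (rect A t) = (rect_prob mu A t)%:E.
Proof.
rewrite /rect_prob big_mkord -prodEFin product_lawP; apply: eq_bigr => s _.
by rewrite fineK// fin_num_measure.
Qed.

(** When [A] is unconstrained up to the end of the block, adding an occurrence of
    [w] at [a] to a cylinder event gives again a cylinder event, whose
    constraints are these. *)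
Definition insert_word (S : finType) (w : seq (selfmap S)) (a : nat)
    (A : nat -> set (selfmap S)) (s : nat) : set (selfmap S) :=
  if (a <= s < a + size w)%N then [set nth point w (s - a)] else A s.

Lemma rect_insert (S : finType) (w : seq (selfmap S)) a A t :
  (forall s, (s < a + size w)%N -> A s = setT) -> (a + size w <= t)%N ->
  rect (insert_word w a A) t = rect A t `&` occurs w a.
Proof.
move=> AT at_; apply/seteqP; split=> F /=; rewrite /insert_word.
  move=> h; split=> [s st|i iw].
    have [/AT-> //|sa] := ltnP s (a + size w)%N.
    by have := h s st; rewrite ltnNge sa andbF.
  have := h (a + i)%N; rewrite leq_addr ltn_add2l iw addKn; apply.
  by rewrite (leq_trans _ at_)// ltn_add2l.
move=> [FA Fw] s st; case: ifPn => [/andP[as_ sw]|_]; last exact: FA.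
by rewrite /= -Fw ?subnKC// ltn_subLR.
Qed.

Lemma rect_prob_insert (R : realType) (S : finType)
    (mu : probability (selfmap S) R) (w : seq (selfmap S)) a A t :
  (forall s, (s < a + size w)%N -> A s = setT) -> (a + size w <= t)%N ->
  rect_prob mu (insert_word w a A) t = word_prob mu w * rect_prob mu A t.
Proof.
move=> AT at_; rewrite /rect_prob /insert_word.
(* [A] is unconstrained up to the end of the block, so there its factors are
   1. *)
rewrite !(@big_cat_nat _ _ _ (a + size w)%N 0 t)//= mulrA; congr (_ * _); last first.
  apply: eq_big_nat => s /andP[sa _]; case: ifPn => // /andP[_].
  by rewrite ltnNge sa.
rewrite [X in _ * X]big1_seq ?mulr1; last first.
  move=> s; rewrite mem_index_iota => /andP[_ /andP[_ sa]].
  by rewrite AT// probability_setT.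
rewrite (@big_cat_nat _ _ _ a 0 (a + size w)%N)//= ?leq_addr// [X in X * _]big1_seq ?mul1r; last first.
  move=> s; rewrite mem_index_iota => /andP[_ /andP[_ sa]].
  by rewrite leqNgt sa/= AT ?probability_setT// ltn_addr.
rewrite -{1}[a]add0n big_addn addKn; apply: eq_big_nat => i /andP[_ iw].
by rewrite leq_addl addnC ltn_add2l iw addKn.
Qed.

(** The first [N] blocks are independent of a cylinder event constraining only
    later positions.  The cylinder [A] is needed for the induction: avoiding one
    more block is a difference of two events of the same form, where the
    occurrence of [w] in block [N] has been absorbed into the cylinder. *)
Lemma product_law_avoids_rect (R : realType) (S : finType)
    (mu : probability (selfmap S) R) (w : seq (selfmap S)) N A t :
  (forall s, (s < N * size w)%N -> A s = setT) -> (N * size w <= t)%N ->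
  product_law mu (rect A t `&` avoids w N) =
  ((1 - word_prob mu w) ^+ N * rect_prob mu A t)%:E.
Proof.
elim: N A => [|N IH] A.
  move=> _ _; rewrite expr0 mul1r -product_law_rect.
  by rewrite (_ : avoids w 0 = setT) ?setIT//; apply/seteqP; split.
rewrite mulSn addnC => AT tN.
have AT' s : (s < N * size w)%N -> A s = setT.
  by move=> sN; rewrite AT// ltn_addr.
have tN' : (N * size w <= t)%N by rewrite (leq_trans _ tN)// leq_addr.
have -> : rect A t `&` avoids w N.+1 =
    (rect A t `&` avoids w N) `\` occurs w (N * size w).
  apply/seteqP; split=> F /=.
    move=> [FA Fw]; split; last exact: Fw (ltnSn N).
    by split=> // b bN; apply: Fw; rewrite ltnS ltnW.
  move=> [[FA Fw] Fo]; split=> // b; rewrite ltnS leq_eqVlt => /orP[/eqP->//|].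
  exact: Fw.
have PD : product_law mu ((rect A t `&` avoids w N) `\` occurs w (N * size w)) =
    (product_law mu (rect A t `&` avoids w N) -
     product_law mu (rect A t `&` avoids w N `&` occurs w (N * size w)))%E.
  apply: measureD.
  - by apply: measurableI; [exact: measurable_rect|exact: measurable_avoids].
  - exact: measurable_occurs.
  - by rewrite -ge0_fin_numE// fin_num_measure//; apply: measurableI;
      [exact: measurable_rect|exact: measurable_avoids].
rewrite PD setIAC -rect_insert// !IH//; last first.
  by move=> s sN; rewrite /insert_word leqNgt sN/= AT'.
rewrite rect_prob_insert// -EFinB; congr _%:E.
by rewrite exprSr mulrA -mulrA mulrBr mulr1 mulrBl mulrA.
Qed.

(** For each of the countably many times s, the event that F_s lies outside the
    support is null. *)
Lemma ae_supp (R : realType) (S : finType) (mu : probability (selfmap S) R) :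
  \forall F \ae product_law mu, forall s, supp mu (F s).
Proof.
apply: (@negligibleS _ _ _ _ (\bigcup_s ~` [set F : mapseq S | supp mu (F s)])).
  by move=> F /= /existsNP[s nF]; exists s.
apply: negligible_bigcup => s; apply/negligibleP.
  by apply: measurableC; exact: measurable_coord.
pose A i : set (selfmap S) := if i == s then ~` supp mu else setT.
have -> : ~` [set F : mapseq S | supp mu (F s)] = rect A s.+1.
  apply/seteqP; split=> F /=.
    by move=> nF i _; rewrite /A; case: eqP => [->|].
  by move=> /(_ s (ltnSn s)); rewrite /A eqxx.
apply: (etrans (product_law_rect mu A s.+1)).
rewrite /rect_prob big_nat_recr//= /A eqxx.
by rewrite measure_supp_compl mulr0.
Qed.

(** Missing [w] in the first [N] blocks has probability [(1 - p) ^ N] with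
    [p > 0], which tends to 0. *)
Lemma ae_occurs (R : realType) (S : finType) (mu : probability (selfmap S) R)
    (w : seq (selfmap S)) : supp_words mu w ->
  \forall F \ae product_law mu, exists a, occurs w a F.
Proof.
move=> [_ ws].
have p_gt0 : 0 < word_prob mu w.
  rewrite /word_prob big_nat; apply: prodr_gt0 => i /andP[_ iw].
  by rewrite fine_gt0// ws ?mem_nth//= ltey_eq fin_num_measure.
have p_le1 : word_prob mu w <= 1.
  rewrite /word_prob; apply: prodr_ile1 => i _; rewrite fine_ge0//=.
  by rewrite -lee_fin fineK ?fin_num_measure// probability_le1.
apply: (@negligibleS _ _ _ _ (\bigcap_N avoids w N)).
  by move=> F /= nF N _ b _ o; apply: nF; exists (b * size w)%N.
have mE : measurable (\bigcap_N avoids w N).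
  by apply: bigcap_measurable => // N _; exact: measurable_avoids.
apply/negligibleP => //; apply/eqP; rewrite -measure_le0.
rewrite -[leLHS]fineK ?fin_num_measure// lee_fin.
have q1 : `|1 - word_prob mu w| < 1.
  by rewrite ger0_norm ?subr_ge0// ltrBlDr ltrDl.
apply: (cvgr_to_ge (cvg_expr q1)); near=> N.
rewrite -lee_fin fineK ?fin_num_measure//.
have := @product_law_avoids_rect R S mu w N (fun=> setT) (N * size w) (fun _ _ => erefl) (leqnn _).
rewrite (_ : rect _ _ = setT) ?setTI; last by apply/seteqP; split.
rewrite /rect_prob big1 ?mulr1 => [<-|i _]; last by rewrite probability_setT.
apply: le_measure; rewrite ?inE//; first exact: measurable_avoids.
by move=> F; apply.
Unshelve. all: by end_near. Qed.

(** * The coalescence number *)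

(** Reading [w], whose image is as small as possible, leaves the least possible
    number of distinct points; after that no further merging can happen, so the
    kernel of [forward F t] is the whole coalescence relation. *)
Lemma num_classes_occurs (R : realType) (S : finType) (mu : probability (selfmap S) R)
    (F : mapseq S) (w : seq (selfmap S)) (a : nat) :
  supp_words mu w ->
  (forall v, supp_words mu v -> (image_card (run w) <= image_card (run v))%N) ->
  (forall s, supp mu (F s)) ->
  occurs w a F ->
  num_classes F = image_card (run w).
Proof.
move=> [w0 _] wmin Fsupp Fw.
have atw : forward F (a + size w) = run w \o forward F a.
  rewrite forwardD; congr (run _ \o _); apply: (@eq_from_nth _ point).
    by rewrite size_mkseq.
  by move=> i; rewrite size_mkseq => iw; rewrite nth_mkseq ?Fw.
(* The time at which [w] has just been read. *)
set t := (a + size w)%N in atw.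
have t0 : (0 < t)%N by rewrite addn_gt0 w0 orbT.
have lower s : (image_card (run w) <= image_card (forward F (t + s)))%N.
  rewrite forward_run; apply: wmin; split=> [|f /mapP[i _ ->]//].
  by rewrite size_mkseq addn_gt0 t0.
have upper : (image_card (forward F t) <= image_card (run w))%N.
  by rewrite atw image_card_comp.
have -> : image_card (run w) = image_card (forward F t).
  by apply/eqP; rewrite eqn_leq upper -[X in forward F X]addn0 lower.
apply: card_kernel_classes => i j; apply/asboolP/eqP => [[s [_ es]]|]; last by exists t.
apply: (@comp_image_card_inj _ (run (mkseq (fun i => F (t + i)%N) s))).
  by rewrite -forwardD (leq_trans upper).
(* Points that have met by time [s] are still together at time [t + s]. *)
rewrite -[LHS]/((run _ \o forward F t) i) -[RHS]/((run _ \o forward F t) j).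
by rewrite -forwardD addnC forwardD /= es.
Qed.

(** A probability measure leaves room for only one almost sure value, so the
    choice made by [xget] is determined. *)
Lemma coalescence_numberE (R : realType) (S : finType)
    (mu : probability (selfmap S) R) k :
  (\forall F \ae product_law mu, num_classes F = k) -> coalescence_number mu = k.
Proof.
move=> ae_k; apply: xget_unique => // l ae_l; apply: contrapT => neq.
have PT : (0 < product_law mu [set: mapseq S])%E by rewrite probability_setT.
have proper := ae_properfilter_algebraOfSetsType PT.
apply: (@filter_not_empty _ _ proper).
by apply: filterS2 ae_k ae_l => F kF lF; apply: neq; rewrite -kF -lF.
Qed.

(** * Words of least rank *)

Lemma exists_min_word (R : realType) (S : finType)
    (mu : probability (selfmap S) R) :
  exists2 w, supp_words mu w &
    forall v, supp_words mu v -> (image_card (run w) <= image_card (run v))%N.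
Proof.
pose P k := `[< exists2 w, supp_words mu w & image_card (run w) = k >].
have exP : exists k, P k.
  have [f suppf] := supp_nonempty mu.
  exists (image_card (run [:: f])); apply/asboolP; exists [:: f] => //.
  by split=> // g; rewrite inE => /eqP->.
case: (ex_minnP exP) => k /asboolP[w suppw <-] wmin; exists w => // v suppv.
by apply: wmin; apply/asboolP; exists v.
Qed.

Lemma supp_words_rev (R : realType) (S : finType)
    (mu : probability (selfmap S) R) (w : seq (selfmap S)) :
  supp_words mu w -> supp_words mu (rev w).
Proof.
by move=> [w0 ws]; split=> [|f]; rewrite ?size_rev// mem_rev; exact: ws.
Qed.

Lemma inf_min (R : realType) (E : set R) (x : R) : E x -> lbound E x -> inf E = x.
Proof.
move=> Ex xlb; apply/eqP; rewrite eq_le ge_inf//=; last by exists x.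
by apply: lb_le_inf => //; exists x.
Qed.

Lemma inf_rank_min_word (R : realType) (S : finType)
    (mu : probability (selfmap S) R) (w : seq (selfmap S)) :
  supp_words mu w ->
  (forall v, supp_words mu v -> (image_card (run w) <= image_card (run v))%N) ->
  inf [set ((\rank (word_mx R fs))%:R : R) | fs in supp_words mu] =
  (image_card (run w))%:R.
Proof.
move=> suppw wmin; apply: inf_min.
  exists (rev w); first exact: supp_words_rev.
  by rewrite word_mxE rank_selfmap_mx revK.
move=> _ [fs suppfs <-]; rewrite word_mxE rank_selfmap_mx ler_nat.
by apply: wmin; exact: supp_words_rev.
Qed.

Theorem theorem3 :
  exists T : nat -> nat,
  forall (R : realType) (n : nat) (S : finType) (alpha : selfmap S -> R)
    (mu : probability (selfmap S) R),
  (0 < n)%N -> #|S| = n ->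
  (forall f, 0 <= alpha f) -> \sum_(f : selfmap S) alpha f = 1 ->
  (forall A : set (selfmap S),
     mu A = (\sum_(f : selfmap S) (alpha f)%:E * \d_f A)%E) ->
  (coalescence_number mu)%:R =
    inf [set ((\rank (word_mx R fs))%:R : R) | fs in supp_words mu]
  /\
  exists fs : seq (selfmap S),
    [/\ supp_words mu fs, (size fs <= T n)%N &
        (\rank (word_mx R fs))%:R =
          inf [set ((\rank (word_mx R gs))%:R : R) | gs in supp_words mu]].
Proof.
exists (fun n => n ^ n)%N => R n S alpha mu _ Sn _ _ _.
have [w suppw wmin] := exists_min_word mu.
rewrite (inf_rank_min_word suppw wmin); split.
  congr _%:R; apply: coalescence_numberE.
  have ae_filter := ae_filter_ringOfSetsType (product_law mu).
  apply: filterS2 (ae_supp mu) (ae_occurs suppw) => F Fsupp [a Fw].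
  exact: (num_classes_occurs suppw wmin Fsupp Fw).
have [w0 ws] := suppw; have [gs [/andP[gs0 gsn] gsw runE]] := shorten_word w0.
have suppgs : supp_words mu gs by split=> // f /gsw; exact: ws.
exists (rev gs); split; first exact: supp_words_rev.
  by rewrite size_rev (leq_trans gsn)// card_ffun Sn.
by rewrite word_mxE rank_selfmap_mx revK runE.
Qed.
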